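(* Let $n\geq 15$ with $n\equiv 3\pmod 4$ and $r=5$. Let $V=\{x_1,\dots,x_{n-10}\}\sqcup\{a,b,c,d,e,f,g,h,k,m\}$ and consider the labelled graph on $V$ with edges: for $1\leq s\leq n-11$, $\{x_s,x_{s+1}\}$ with label $1$ if $s$ is odd and label $0$ if $s$ is even; $\{x_{n-10},a\}$ with label $1$; $\{a,b\}$ with label $2$; $\{b,c\}$ with label $3$; $\{c,d\}$ with label $4$; $\{e,f\}$ with label $4$; $\{f,g\}$ with label $3$; $\{c,e\}$ and $\{d,f\}$ with label $2$; $\{h,k\}$ with label $4$; $\{k,m\}$ with label $3$; $\{h,e\}$ with the two labels $1$ and $3$; $\{k,f\}$ with label $1$; and $\{m,g\}$ with the three labels $1,2,4$. Then $G\cong A_n$ and $(G,(\rho_0,\dots,\rho_4))$ is a string C-group of rank 5 with Schläfli type $\{n-9,6,5,3\}$.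
   Context: A string group generated by involutions (sggi) of rank $r$ is a pair $(G,(\rho_0,\dots,\rho_{r-1}))$ where $\rho_0,\dots,\rho_{r-1}$ are involutions generating the group $G$ such that $(\rho_i\rho_j)^2=1$ whenever $|i-j|\geq 2$. It is a string C-group if in addition it satisfies the intersection property: for all $J,K\subseteq\{0,\dots,r-1\}$, $\langle \rho_j : j\in J\rangle\cap\langle\rho_k : k\in K\rangle=\langle \rho_j : j\in J\cap K\rangle$. The Schläfli type is $\{p_1,\dots,p_{r-1}\}$ where $p_i$ is the order of $\rho_{i-1}\rho_i$. Labelled-graph convention: the vertex set $V$ is finite, and each edge $\{a,b\}$ ($a\neq b$) carries one or more labels from $\{0,\dots,r-1\}$, the edges carrying any given label being pairwise disjoint; $\rho_k$ denotes the permutation of $V$ equal to the product of the transpositions $(a\,b)$ over all edges $\{a,b\}$ carrying label $k$, and $G=\langle\rho_0,\dots,\rho_{r-1}\rangle\leq \mathrm{Sym}(V)$. *)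

(* Defs.v *)
From HB Require Import structures.
From mathcomp Require Import all_boot all_order all_fingroup all_solvable.
Set Implicit Arguments. Unset Strict Implicit. Unset Printing Implicit Defensive.

Local Open Scope group_scope.

Definition gen_sub (gT : finGroupType) (r : nat) (rho : 'I_r -> gT)
  (J : {set 'I_r}) : {set gT} := <<rho @: J>>.

Definition gen_group (gT : finGroupType) (r : nat) (rho : 'I_r -> gT) : {set gT} :=
  gen_sub rho setT.

Definition sggi (gT : finGroupType) (r : nat) (rho : 'I_r -> gT) : Prop :=
  (forall i : 'I_r, #[rho i] = 2) /\
  (forall i j : 'I_r, (i + 2 <= j)%N || (j + 2 <= i)%N ->
       (rho i * rho j) ^+ 2 = 1).

Definition intersection_property (gT : finGroupType) (r : nat)
  (rho : 'I_r -> gT) : Prop :=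
  forall J K : {set 'I_r},
    gen_sub rho J :&: gen_sub rho K = gen_sub rho (J :&: K).

Definition string_C_group (gT : finGroupType) (r : nat) (rho : 'I_r -> gT) : Prop :=
  sggi rho /\ intersection_property rho.

(* Schlafli type {p_1,...,p_{r-1}}: p_i = order of rho_{i-1} rho_i.
   The list p is [:: p_1; ...; p_{r-1}], so p_{j+1} = nth 0 p j. *)
Definition schlafli_type (gT : finGroupType) (r : nat) (rho : 'I_r -> gT)
  (p : seq nat) : Prop :=
  size p = r.-1 /\
  forall i j : 'I_r, j.+1 = val i -> #[rho j * rho i] = nth 0%N p j.

Definition tp (n u v : nat) : {perm 'I_n} :=
  match insub u, insub v with
  | Some i, Some j => tperm i j
  | _, _ => 1
  end.

Definition vx (s : nat) : nat := s.-1.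
Definition va n := (n - 10)%N.
Definition vb n := (n - 9)%N.
Definition vc n := (n - 8)%N.
Definition vd n := (n - 7)%N.
Definition ve n := (n - 6)%N.
Definition vf n := (n - 5)%N.
Definition vg n := (n - 4)%N.
Definition vh n := (n - 3)%N.
Definition vk n := (n - 2)%N.
Definition vm n := (n - 1)%N.

Definition graph_edges (n : nat) : seq (nat * nat * seq nat) :=
  [seq (vx s, vx s.+1, [:: if odd s then 1 else 0]%N) | s <- iota 1 (n - 11)] ++
  [:: (vx (n - 10), va n, [:: 1]%N);
      (va n, vb n, [:: 2]%N);
      (vb n, vc n, [:: 3]%N);
      (vc n, vd n, [:: 4]%N);
      (ve n, vf n, [:: 4]%N);
      (vf n, vg n, [:: 3]%N);
      (vc n, ve n, [:: 2]%N);
      (vd n, vf n, [:: 2]%N);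
      (vh n, vk n, [:: 4]%N);
      (vk n, vm n, [:: 3]%N);
      (vh n, ve n, [:: 1; 3]%N);
      (vk n, vf n, [:: 1]%N);
      (vm n, vg n, [:: 1; 2; 4]%N)].

Definition rho (n : nat) (k : 'I_5) : {perm 'I_n} :=
  \prod_(e <- graph_edges n | val k \in e.2) tp n e.1.1 e.1.2.

(* Main.v *)
(* Let w = n - 11. The group <rho_1, ..., rho_4> preserves the last 11 vertices, where it acts as
   L_2(11), and it acts on the remaining ones only through the simultaneous swap
   (x_1 x_2)(x_3 x_4) ... of rho_1; so all questions about it are finite computations that do not
   depend on n.

   The intersection property is obtained by induction on the rank: it holds for an interval of
   generators if it holds after dropping either end and the two corresponding subgroups meet in
   the group of the inner generators. Each such intersection <J> /\ <L> is handled by listing the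
   cosets of <K> in <J> and observing that <L> preserves suitable vertex sets that no nontrivial
   coset preserves. For instance <rho_0, ..., rho_3> preserves {d, f, g, k, m}, whose stabilizer in
   <rho_1, ..., rho_4> has index 11 and equals <rho_1, rho_2, rho_3>.

   For an element g of <rho_1, ..., rho_4> fixing x_1, ..., x_(n-11), the commutator of g and rho_0
   is a 3-cycle through x_(n-11) and x_(n-10). These yield all 3-cycles on the last 12 vertices;
   rho_0 and rho_1 fix b and c and carry the cycles (b, c, y) along the path to all y, so G
   contains the alternating group, and a parity count gives equality. *)
Require Import Defs.
From HB Require Import structures.
From mathcomp Require Import all_boot all_order all_fingroup all_solvable.
From mathcomp Require Import zify.
Set Implicit Arguments. Unset Strict Implicit. Unset Printing Implicit Defensive.
Local Open Scope group_scope.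

(** * The intersection property by induction on the rank *)

Lemma gen_ind_r (gT : finGroupType) (A : {set gT}) (P : gT -> Prop) :
  P 1 -> (forall x a, P x -> a \in A -> P (x * a)) ->
  forall x, x \in <<A>> -> P x.
Proof.
move=> P1 PM x /gen_prodgP[m [c cA ->]].
elim: m c cA => [|m IHm] c cA; first by rewrite big_ord0.
by rewrite big_ord_recr; apply: PM => //; apply: IHm => i.
Qed.

Canonical gen_sub_group (gT : finGroupType) r (rho : 'I_r -> gT) (J : {set 'I_r}) :=
  Eval hnf in [group of gen_sub rho J].

Lemma gen_sub_mem (gT : finGroupType) r (rho : 'I_r -> gT) (J : {set 'I_r}) i :
  i \in J -> rho i \in gen_sub rho J.
Proof. by move=> Ji; rewrite mem_gen ?imset_f. Qed.

Lemma gen_subS (gT : finGroupType) r (rho : 'I_r -> gT) (J K : {set 'I_r}) :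
  J \subset K -> gen_sub rho J \subset gen_sub rho K.
Proof. by move=> sJK; rewrite genS ?imsetS. Qed.

Lemma gen_sub0 (gT : finGroupType) r (rho : 'I_r -> gT) :
  gen_sub rho set0 = 1.
Proof. by rewrite /gen_sub imset0 gen0. Qed.

Lemma gen_sub_ind (gT : finGroupType) r (rho : 'I_r -> gT) (J : {set 'I_r}) (P : gT -> Prop) :
  P 1 -> (forall x i, P x -> i \in J -> P (x * rho i)) ->
  forall x, x \in gen_sub rho J -> P x.
Proof.
by move=> P1 PM; apply: gen_ind_r => // x _ Px /imsetP[i Ji ->]; apply: PM.
Qed.

Definition far_commute (gT : finGroupType) r (rho : 'I_r -> gT) : Prop :=
  forall i j : 'I_r, (i + 2 <= j)%N -> commute (rho i) (rho j).

(** The two subgroups centralize each other, so their join is their product. *)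
Lemma gen_subU (gT : finGroupType) r (rho : 'I_r -> gT) (J K : {set 'I_r}) :
  far_commute rho ->
  (forall i j, i \in J -> j \in K -> (i + 2 <= j)%N) ->
  gen_sub rho (J :|: K) = gen_sub rho J * gen_sub rho K.
Proof.
move=> Crho far.
rewrite -cent_joinEr; first by rewrite /gen_sub imsetU joing_idl joing_idr.
rewrite gen_subG centsC gen_subG; apply/centsP => _ /imsetP[i Ji ->] _ /imsetP[j Kj ->].
by apply: Crho; apply: far.
Qed.

Definition ip_on (gT : finGroupType) r (rho : 'I_r -> gT) (A : {set 'I_r}) : Prop :=
  forall J K : {set 'I_r}, J \subset A -> K \subset A ->
    gen_sub rho J :&: gen_sub rho K = gen_sub rho (J :&: K).

Lemma ip_on_mem (gT : finGroupType) r (rho : 'I_r -> gT) (A J K L : {set 'I_r}) x :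
  ip_on rho A -> J \subset A -> K \subset A -> J :&: K \subset L ->
  x \in gen_sub rho J -> x \in gen_sub rho K -> x \in gen_sub rho L.
Proof.
move=> ipA sJ sK sL Jx Kx; apply: (subsetP (gen_subS rho sL)).
by rewrite -(ipA J K) // inE Jx.
Qed.

Lemma ip_on1 (gT : finGroupType) r (rho : 'I_r -> gT) (p : 'I_r) :
  ip_on rho [set p].
Proof.
have triv (J K : {set 'I_r}) : J \subset K ->
    gen_sub rho J :&: gen_sub rho K = gen_sub rho (J :&: K).
  by move=> sJK; rewrite (setIidPl sJK) (setIidPl (gen_subS _ sJK)).
move=> J K; rewrite !subset1 => /orP[]/eqP-> /orP[]/eqP->; try exact/triv/subxx.
- by rewrite setIC (setIC [set p]) triv ?sub0set.
- by rewrite triv ?sub0set.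
Qed.

(** The missing index [j] leaves two parts of [J] whose generators commute. *)
Lemma gen_sub_split (gT : finGroupType) r (rho : 'I_r -> gT) (J : {set 'I_r}) (j : 'I_r) x :
  far_commute rho -> j \notin J -> x \in gen_sub rho J ->
  exists2 u, u \in gen_sub rho [set i in J | i < j] &
  exists2 v, v \in gen_sub rho [set i in J | j < i] & x = u * v.
Proof.
move=> Crho nJj.
have EJ : J = [set i in J | i < j] :|: [set i in J | j < i].
  apply/setP=> i; rewrite !inE -andb_orr; case: (boolP (i \in J)) => //= Ji.
  by apply/esym; rewrite -neq_ltn; apply: contraNN nJj => /eqP/val_inj<-.
rewrite {1}EJ gen_subU //; last first.
  by move=> i k; rewrite !inE => /andP[_ ij] /andP[_ jk]; rewrite addn2; apply: leq_trans jk.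
by case/mulsgP=> u v Hu Hv ->; exists u; last exists v.
Qed.

(* The tail of [J] below a missing index commutes with the tail above it. If [x] is written as
   [u v] along a gap [j] of [J] and as [u' v'] along a gap [k >= j] of [K], then [u'^-1 u = v' v^-1]
   lies in the groups of both [A :\ p] and [A :\ q], hence comes from the indices strictly
   between [j] and [k], and the two smaller intersection properties finish the proof. *)
Lemma ip_extend (gT : finGroupType) r (rho : 'I_r -> gT) (A : {set 'I_r}) (p q : 'I_r) :
  far_commute rho -> {in A, forall i : 'I_r, p <= i <= q} ->
  ip_on rho (A :\ p) -> ip_on rho (A :\ q) ->
  gen_sub rho (A :\ p) :&: gen_sub rho (A :\ q) \subset gen_sub rho (A :\ p :\ q) ->
  ip_on rho A.
Proof.
move=> Crho pq ipp ipq mid.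
pose G := gen_sub_group rho.
have GE J : gen_sub rho J = G J by [].
have key (j k : 'I_r) (J K : {set 'I_r}) x : j <= k -> j \in A -> k \in A ->
    j \notin J -> k \notin K ->
    J \subset A -> K \subset A -> x \in gen_sub rho J -> x \in gen_sub rho K ->
    x \in gen_sub rho (J :&: K).
  move=> jk Aj Ak nJj nKk sJ sK Jx Kx.
  have [u Hu [v Hv Ex]] := gen_sub_split Crho nJj Jx.
  have [u' Hu' [v' Hv' Ex']] := gen_sub_split Crho nKk Kx.
  have sJA := subsetP sJ; have sKA := subsetP sK.
  have [/andP[pj jq] /andP[pk kq]] := (pq _ Aj, pq _ Ak).
  have sub (B C : {set 'I_r}) y : y \in G B -> (forall i, i \in B -> i \in C) -> y \in G C.
    by move=> By sBC; apply: subsetP By; apply/gen_subS/subsetP.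
  have sp (B : {set 'I_r}) : (forall i, i \in B -> (i \in A) && (p < i)) -> B \subset A :\ p.
    move=> HB; apply/subsetP=> i /HB/andP[Ai pi]; rewrite !inE Ai andbT.
    by apply: contraTneq pi => ->; rewrite ltnn.
  have sq (B : {set 'I_r}) : (forall i, i \in B -> (i \in A) && (i < q)) -> B \subset A :\ q.
    move=> HB; apply/subsetP=> i /HB/andP[Ai pi]; rewrite !inE Ai andbT.
    by apply: contraTneq pi => ->; rewrite ltnn.
  rewrite !GE in Hu Hv Hu' Hv' *.
  pose Alo := [set i in A | i < k]; pose Ahi := [set i in A | j < i].
  pose M := [set i in A | j < i < k].
  have sub1 : [set i in J | i < j] \subset A :\ q.
    by apply: sq => i; rewrite !inE => /andP[/sJA-> ij]; rewrite (leq_trans ij).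
  have sub2 : [set i in J | j < i] \subset A :\ p.
    by apply: sp => i; rewrite !inE => /andP[/sJA-> ij]; rewrite (leq_ltn_trans pj).
  have sub3 : [set i in K | i < k] \subset A :\ q.
    by apply: sq => i; rewrite !inE => /andP[/sKA-> ij]; rewrite (leq_trans ij).
  have sub4 : [set i in K | k < i] \subset A :\ p.
    by apply: sp => i; rewrite !inE => /andP[/sKA-> ij]; rewrite (leq_ltn_trans pk).
  have sub5 : M \subset A :\ p.
    by apply: sp => i; rewrite !inE => /andP[-> /andP[ji ik]]; rewrite (leq_ltn_trans pj).
  have sub6 : M \subset A :\ q.
    by apply: sq => i; rewrite !inE => /andP[-> /andP[ji ik]]; rewrite (leq_trans ik).
  have sub7 : Alo \subset A :\ q.
    by apply: sq => i; rewrite !inE => /andP[-> ik]; rewrite (leq_trans ik).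
  have sub8 : Ahi \subset A :\ p.
    by apply: sp => i; rewrite !inE => /andP[-> ik]; rewrite (leq_ltn_trans pj).
  pose w := u'^-1 * u.
  have Ew : w = v' * v^-1.
    by rewrite /w; apply: (mulgI u'); rewrite mulKVg mulgA -Ex' Ex mulgK.
  have wlo : w \in G Alo.
    rewrite groupM ?groupV //.
      by apply: sub Hu' _ => i; rewrite !inE => /andP[/sKA->].
    by apply: sub Hu _ => i; rewrite !inE => /andP[/sJA->] /leq_trans->.
  have whi : w \in G Ahi.
    rewrite Ew groupM ?groupV //.
      by apply: sub Hv' _ => i; rewrite !inE => /andP[/sKA->]; apply: leq_ltn_trans.
    by apply: sub Hv _ => i; rewrite !inE => /andP[/sJA->].
  have wm : w \in G (A :\ p :\ q).
    apply: (subsetP mid); rewrite inE !GE.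
    by rewrite (subsetP (gen_subS _ sub7)) ?(subsetP (gen_subS _ sub8)).
  have sAp : A :\ p :\ q \subset A :\ p by rewrite subD1set.
  have sAq : A :\ p :\ q \subset A :\ q by rewrite setSD // subD1set.
  have w1 : w \in G (Alo :&: (A :\ p :\ q)) by apply: (ip_on_mem ipq sub7 sAq).
  have w2 : w \in G (Ahi :&: (A :\ p :\ q)) by apply: (ip_on_mem ipp sub8 sAp).
  have wM : w \in G M.
    apply: (ip_on_mem ipq _ _ _ w1 w2).
    - by rewrite subIset // sub7.
    - by rewrite subIset // sAq orbT.
    - apply/subsetP=> i; rewrite !inE.
      by case/andP=> /andP[/andP[-> ->] _] /andP[/andP[_ ->]].
  have far (B C : {set 'I_r}) (l : 'I_r) : (forall i, i \in B -> i < l) ->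
      (forall i, i \in C -> l < i) -> forall i h, i \in B -> h \in C -> i + 2 <= h.
    by move=> HB HC i h /HB il /HC; rewrite addn2; apply: leq_trans.
  (* Since [u' = u * w^-1], it also lies in the group of [M] and the part of [J] below [j]; by [ipq]
     only indices of [J :&: K] below [j] and of [K :&: M] remain. *)
  have : u' \in G (([set i in J :&: K | i < j]) :|: (K :&: M)).
    have Hu2 : u' \in G ([set i in J | i < j] :|: M).
      have -> : u' = u * w^-1 by rewrite /w invMg invgK mulKVg.
      rewrite groupM ?groupV //.
        by apply: sub Hu _ => i Hi; rewrite inE Hi.
      by apply: sub wM _ => i Hi; rewrite inE Hi orbT.
    apply: (ip_on_mem ipq sub3 _ _ Hu' Hu2); first by rewrite subUset sub1.
    apply/subsetP=> i; rewrite !inE.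
    case/andP=> /andP[-> ik] /orP[/andP[-> ij]|/andP[-> /andP[-> ->]]]; last by rewrite orbT.
    by rewrite ij.
  rewrite -GE gen_subU //; last first.
    by apply: (far _ _ j) => i; rewrite !inE => /andP[] // _ /andP[_ /andP[]].
  case/mulsgP=> a b Ha Hb Eu'.
  (* [a^-1 * u] lies in the groups of two disjoint index sets, one below [j] and one above, so it is
     trivial; this leaves [w = b^-1]. *)
  have u_a : u = a.
    have H1 : a^-1 * u \in G [set i in J | i < j].
      rewrite groupM ?groupV //.
      by apply: sub Ha _ => i; rewrite !inE => /andP[/andP[->]].
    have H2 : a^-1 * u \in G M.
      have -> : a^-1 * u = b * w by rewrite /w Eu' invMg -!mulgA mulKVg.
      rewrite groupM //.
      by apply: sub Hb _ => i; rewrite inE => /andP[].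
    have : a^-1 * u \in gen_sub rho set0.
      apply: (ip_on_mem ipq sub1 sub6 _ H1 H2); apply/subsetP=> i; rewrite !inE.
      case/andP=> /andP[_ ij] /andP[_ /andP[ji _]].
      by have := ltn_trans ij ji; rewrite ltnn.
    rewrite gen_sub0 inE => /eqP E.
    by rewrite -[u](mulKVg a) E mulg1.
  have wK : w \in G (K :&: M).
    have -> : w = b^-1 by rewrite /w Eu' u_a invMg mulgKV.
    by rewrite groupV.
  have : v \in G ((J :&: M) :|: ([set i in J :&: K | k < i])).
    have Hv2 : v \in G (M :|: [set i in K | k < i]).
      have -> : v = w^-1 * v' by rewrite Ew invMg invgK mulgKV.
      rewrite groupM ?groupV //.
        by apply: sub wM _ => i Hi; rewrite inE Hi.
      by apply: sub Hv' _ => i Hi; rewrite inE Hi orbT.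
    apply: (ip_on_mem ipp sub2 _ _ Hv Hv2); first by rewrite subUset sub5.
    apply/subsetP=> i; rewrite !inE.
    case/andP=> /andP[-> ik] /orP[/andP[-> /andP[-> ->]] //|/andP[-> ij]].
    by rewrite ij orbT.
  rewrite -GE gen_subU //; last first.
    by apply: (far _ _ k) => i; rewrite !inE => /andP[] // _ /andP[_ /andP[]].
  case/mulsgP=> s t Hs Ht Ev.
  have v'_t : v' = t.
    have H1 : v' * t^-1 \in G [set i in K | k < i].
      rewrite groupM ?groupV //.
      by apply: sub Ht _ => i; rewrite !inE => /andP[/andP[_ ->]].
    have H2 : v' * t^-1 \in G M.
      have -> : v' * t^-1 = w * s by rewrite Ew Ev invMg mulgA mulgKV.
      rewrite groupM //.
      by apply: sub Hs _ => i; rewrite inE => /andP[].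
    have : v' * t^-1 \in gen_sub rho set0.
      apply: (ip_on_mem ipp sub4 sub5 _ H1 H2); apply/subsetP=> i; rewrite !inE.
      case/andP=> /andP[_ ij] /andP[_ /andP[_ ji]].
      by have := ltn_trans ij ji; rewrite ltnn.
    rewrite gen_sub0 inE => /eqP E.
    by rewrite -[v'](mulgKV t) E mul1g.
  (* Now [x = a * (s * t)]; the outer factors use indices of [J :&: K], and [s = w^-1] lies in the
     groups of both [J :&: M] and [K :&: M]. *)
  rewrite Ex Ev u_a !groupM //.
  - by apply: sub Ha _ => i; rewrite inE => /andP[].
  - have Ews : w = s^-1 by rewrite Ew Ev v'_t invMg mulKVg.
    have wJ : w \in G (J :&: M) by rewrite Ews groupV.
    rewrite -groupV -Ews.
    apply: (ip_on_mem ipq _ _ _ wJ wK); try by rewrite subIset // sub6 orbT.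
    by apply/subsetP=> i; rewrite !inE => /andP[/andP[-> _] /andP[->]].
  - by apply: sub Ht _ => i; rewrite inE => /andP[].
move=> J K sJ sK; apply/eqP; rewrite eqEsubset; apply/andP; split; last first.
  by rewrite subsetI !gen_subS ?subsetIl ?subsetIr.
apply/subsetP=> x /setIP[Jx Kx].
have [sAJ|/subsetPn[j Aj nJj]] := boolP (A \subset J).
  by rewrite (setIidPr (subset_trans sK sAJ)).
have [sAK|/subsetPn[k Ak nKk]] := boolP (A \subset K).
  by rewrite (setIidPl (subset_trans sJ sAK)).
have [jk|/ltnW kj] := leqP j k; first exact: (key j k).
by rewrite setIC; apply: (key k j).
Qed.

(** * The action of the generators *)

(* [swp] is rho_1 on x_1, ..., x_(n-11) and [zig w] is rho_0, where [w = n - 11] and x_s is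
   the vertex [s - 1]. *)
Definition swp (i : nat) : nat := if odd i then i.-1 else i.+1.

Lemma swpK : involutive swp.
Proof. by move=> i; rewrite /swp; case: (boolP (odd i)) => oi; case: ifP => ?; lia. Qed.

Lemma swp_lt w i : ~~ odd w -> (i < w)%N -> (swp i < w)%N.
Proof. by rewrite /swp; case: ifP => ?; lia. Qed.

Definition zig (w i : nat) : nat :=
  if (0 < i <= w)%N then (if odd i then i.+1 else i.-1) else i.

Definition tstep (i : nat) (e : nat * nat) : nat :=
  if i == e.1 then e.2 else if i == e.2 then e.1 else i.

Lemma val_tp n u v (x : 'I_n) : (u < n)%N -> (v < n)%N ->
  val (tp n u v x) = tstep (val x) (u, v).
Proof.
move=> un vn; rewrite /tp /tstep (insubT (fun i => i < n)%N un) (insubT (fun i => i < n)%N vn) /=.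
case: tpermP => [->|->|nu nv] /=.
- by rewrite eqxx.
- by rewrite eqxx; case: eqP.
- case: eqP => [xu|_]; first by case: nu; apply: val_inj.
  by case: eqP => [xv|//]; case: nv; apply: val_inj.
Qed.

Lemma val_prod_tp n (es : seq (nat * nat * seq nat)) (P : pred (nat * nat * seq nat)) (x : 'I_n) :
  all (fun e => (e.1.1 < n) && (e.1.2 < n))%N es ->
  val ((\prod_(e <- es | P e) tp n e.1.1 e.1.2) x) =
  foldl tstep (val x) [seq e.1 | e <- es & P e].
Proof.
elim: es x => [|[[u v] s] es IH] x /=; first by rewrite big_nil perm1.
case/andP=> /andP[un vn] les; rewrite big_cons.
case: ifP => _ /=; last exact: IH.
by rewrite permM IH // val_tp.
Qed.

Lemma foldl_swp m i :
  foldl tstep i [seq (s.-1, s) | s <- iota 1 m.*2 & odd s] =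
  if (i < m.*2)%N then swp i else i.
Proof.
elim: m => [|m IH] //.
rewrite (_ : m.+1.*2 = m.*2 + 2)%N; last by rewrite doubleS addn2.
rewrite iotaD filter_cat map_cat foldl_cat IH add1n /= odd_double /= /tstep /= /swp.
case: (boolP (odd i)) => oi; case: (ltnP i m.*2) => im; repeat case: ifP => ?; lia.
Qed.

(** The last edge joins [m.*2.-1] to [m.*2]; with [w = m.*2] the latter is x_(n-10), the first of
    the last 11 vertices. *)
Lemma foldl_zig m i :
  foldl tstep i [seq (s.-1, s) | s <- iota 1 m.*2 & ~~ odd s] = zig m.*2 i.
Proof.
elim: m => [|m IH]; first by case: i.
rewrite (_ : m.+1.*2 = m.*2 + 2)%N; last by rewrite doubleS addn2.
rewrite iotaD filter_cat map_cat foldl_cat IH add1n /= odd_double /= /tstep /= /zig.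
case: (boolP (odd i)) => oi; case: (ltnP 0 i) => i0; case: (leqP i m.*2) => im /=;
  repeat case: ifP => ?; lia.
Qed.

(* The vertices x_(n-10), a, b, c, d, e, f, g, h, k, m are numbered 0, ..., 10 in this order. *)
Definition wedges : seq (nat * nat * seq nat) :=
  [:: (0, 1, [:: 1]); (1, 2, [:: 2]); (2, 3, [:: 3]); (3, 4, [:: 4]);
      (5, 6, [:: 4]); (6, 7, [:: 3]); (3, 5, [:: 2]); (4, 6, [:: 2]);
      (8, 9, [:: 4]); (9, 10, [:: 3]); (8, 5, [:: 1; 3]); (9, 6, [:: 1]);
      (10, 7, [:: 1; 2; 4])]%N.

Definition wshift (w : nat) (e : nat * nat * seq nat) : nat * nat * seq nat :=
  ((w + e.1.1)%N, (w + e.1.2)%N, e.2).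

Lemma graph_edgesE w : graph_edges (w + 11) =
  [seq (s.-1, s, [:: if odd s then 1 else 0]%N) | s <- iota 1 w] ++
  [seq wshift w e | e <- wedges].
Proof.
rewrite /graph_edges /va /vb /vc /vd /ve /vf /vg /vh /vk /vm /vx /wshift /=.
rewrite addnK.
have sub k j : (k + j = 11)%N -> (w + 11 - k = w + j)%N by lia.
by rewrite (sub 10%N 1%N) // (sub 9%N 2%N) // (sub 8%N 3%N) // (sub 7%N 4%N) // (sub 6%N 5%N) //
  (sub 5%N 6%N) // (sub 4%N 7%N) // (sub 3%N 8%N) // (sub 2%N 9%N) // (sub 1%N 10%N) // addn1 addn0.
Qed.

Definition wact (k j : nat) : nat :=
  foldl tstep j [seq e.1 | e <- wedges & k \in e.2].

Lemma foldl_wshift_ge w j es :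
  foldl tstep (w + j)%N [seq e.1 | e <- [seq wshift w e | e <- es]] =
  (w + foldl tstep j [seq e.1 | e <- es])%N.
Proof.
elim: es j => //= -[[u v] s] es IH j /=; rewrite -IH; congr foldl.
by rewrite /tstep /= !eqn_add2l; case: ifP => // _; case: ifP.
Qed.

Lemma foldl_wshift_lt w i es : (i < w)%N ->
  foldl tstep i [seq e.1 | e <- [seq wshift w e | e <- es]] = i.
Proof.
move=> iw; elim: es => //= -[[u v] s] es IH /=; rewrite -[RHS]IH; congr foldl.
rewrite /tstep /=; repeat case: eqP => ?; lia.
Qed.

Lemma val_rho w (k : 'I_5) (x : 'I_(w + 11)) :
  val (rho (w + 11) k x) =
  foldl tstep (foldl tstep (val x)
    [seq (s.-1, s) | s <- iota 1 w & val k == (if odd s then 1 else 0)%N])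
    [seq e.1 | e <- [seq wshift w e | e <- wedges & val k \in e.2]].
Proof.
rewrite /rho val_prod_tp graph_edgesE.
  rewrite filter_cat map_cat foldl_cat !filter_map -!map_comp; congr foldl; congr foldl.
  by congr map; apply: eq_filter => s /=; rewrite inE.
rewrite all_cat; apply/andP; split; last by rewrite all_map; apply/allP => e; rewrite !inE;
  do !(case/orP=> [/eqP->|]); try move/eqP->; rewrite /= !ltn_add2l.
rewrite all_map; apply/allP => s; rewrite mem_iota /=; lia.
Qed.

Lemma val_rho0 w (x : 'I_(w + 11)) : ~~ odd w ->
  val (rho (w + 11) (@Ordinal 5 0 isT) x) = zig w (val x).
Proof.
move=> ew; rewrite val_rho /=; move: (val x) => i.
have {2}-> : w = w./2.*2 by lia.
have {1}-> : w = w./2.*2 by lia.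
rewrite -foldl_zig; congr foldl; congr map; apply: eq_filter => s.
by case: odd.
Qed.

(* The pair [(s, l)] encodes the permutation that acts on the last 11 vertices by the list [l]
   of images and on x_1, ..., x_(n-11) as [swp] if [s], trivially otherwise; every element of
   <rho_1, ..., rho_4> has this form. *)
Definition elt : Type := (bool * seq nat)%type.

Definition eact (w : nat) (e : elt) (i : nat) : nat :=
  if (i < w)%N then (if e.1 then swp i else i) else (w + nth 0%N e.2 (i - w))%N.

(** [e] acts first, as in the product of permutations. *)
Definition ecomp (e f : elt) : elt :=
  (e.1 (+) f.1, [seq nth 0%N f.2 (nth 0%N e.2 j) | j <- iota 0 11]).

Definition eid : elt := (false, iota 0 11).

Definition is_id (e : elt) : bool :=
  ~~ e.1 && all (fun j => nth 0%N e.2 j == j) (iota 0 11).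

Definition gen (k : nat) : elt := (k == 1%N, [seq wact k j | j <- iota 0 11]).

Arguments gen : simpl never.
Arguments ecomp : simpl never.

Lemma nth_gen k j : (j < 11)%N -> nth 0%N (gen k).2 j = wact k j.
Proof. by move=> lj; rewrite (nth_map 0%N) ?size_iota // nth_iota. Qed.

Lemma nth_comp e f j : (j < 11)%N ->
  nth 0%N (ecomp e f).2 j = nth 0%N f.2 (nth 0%N e.2 j).
Proof. by move=> lj; rewrite (nth_map 0%N) ?size_iota // nth_iota. Qed.

Definition rep (w : nat) (g : {perm 'I_(w + 11)}) (e : elt) : Prop :=
  forall i, val (g i) = eact w e (val i).

Lemma rep_rho w (k : 'I_5) : ~~ odd w -> 0 < k ->
  rep (rho (w + 11) k) (gen k).
Proof.
move=> ew k0 i; rewrite val_rho /eact.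
have -> : foldl tstep i [seq (s.-1, s) | s <- iota 1 w & k == (if odd s then 1 else 0)%N :> nat]
   = if (i < w)%N && (k == 1 :> nat)%N then swp i else i.
  have [k1|k1] := eqVneq (val k) 1%N; last first.
    rewrite andbF (eq_filter (a2 := pred0)) ?filter_pred0 // => s /=.
    by case: odd; [exact: negPf | rewrite eqn0Ngt k0].
  rewrite andbT; move: (val i) => {}i.
  have {2}-> : w = w./2.*2 by lia.
  have {1}-> : w = w./2.*2 by lia.
  rewrite -foldl_swp; congr foldl; congr map; apply: eq_filter => s.
  by rewrite k1; case: odd.
rewrite -[(gen k).1]/(k == 1 :> nat)%N; case: ltnP => /= iw.
  rewrite foldl_wshift_lt; first by case: ifP.
  case: ifP => // _; rewrite /swp; case: ifP => ?; lia.
rewrite -{1}(subnKC iw) foldl_wshift_ge; congr addn.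
have lj : (i - w < 11)%N by case: i iw => i /=; lia.
by rewrite nth_gen.
Qed.

Lemma rep1 w : rep (1 : {perm 'I_(w + 11)}) eid.
Proof.
move=> i; rewrite perm1 /eact -[eid.1]/false; case: ltnP => // iw.
by rewrite nth_iota ?add0n ?subnKC //; case: i iw => i /=; lia.
Qed.

Lemma rep_comp w (g h : {perm 'I_(w + 11)}) e f : ~~ odd w ->
  rep g e -> rep h f -> rep (g * h) (ecomp e f).
Proof.
move=> ew rg rh i; rewrite permM rh rg /eact -[(ecomp e f).1]/(e.1 (+) f.1).
case: (ltnP (val i) w) => [iw|wi] /=.
  have siw : (swp (val i) < w)%N by rewrite swp_lt.
  by case: e.1; rewrite ?siw ?iw //=; case: f.1 => //=; rewrite swpK.
rewrite ltnNge leq_addr /= addKn.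
have lj : (i - w < 11)%N by case: i wi => i /=; lia.
by rewrite nth_comp.
Qed.

Lemma rep_inj w (g h : {perm 'I_(w + 11)}) e : rep g e -> rep h e -> g = h.
Proof. by move=> rg rh; apply/permP => i; apply: val_inj; rewrite rg rh. Qed.

(** The encoding is faithful: [swp] moves position 0, so the Boolean can be read off there. *)
Lemma rep_eq1 w (g : {perm 'I_(w + 11)}) e : (0 < w)%N -> rep g e ->
  (g == 1) = is_id e.
Proof.
move=> w0 rg; apply/eqP/idP => [g1|/andP[/negPf e1 /allP ej]]; last first.
  apply/permP => i; apply: val_inj; rewrite perm1 rg /eact e1.
  case: ltnP => // wi; rewrite (eqP (ej _ _)) ?subnKC // mem_iota.
  case: i wi => i /=; lia.
apply/andP; split.
  have lt0 : (0 < w + 11)%N by rewrite addn_gt0 w0.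
  have := rg (Ordinal lt0); rewrite g1 perm1 /eact /= w0.
  by case: e.1.
apply/allP => j; rewrite mem_iota add0n => /= lj.
have ltj : (w + j < w + 11)%N by rewrite ltn_add2l.
have := rg (Ordinal ltj); rewrite g1 perm1 /eact /= ltnNge leq_addr /= addKn => /eqP.
by rewrite eqn_add2l eq_sym.
Qed.

Lemma rep_expg w (g : {perm 'I_(w + 11)}) e m : ~~ odd w ->
  rep g e -> rep (g ^+ m) (iter m (ecomp^~ e) eid).
Proof.
move=> ew rg; elim: m => [|m IH]; first exact: rep1.
by rewrite expgSr /=; apply: rep_comp.
Qed.

(** [g] fixes x_1, ..., x_(n-10), the only vertices that rho_0 can move. *)
Lemma commute_rho0 w (g : {perm 'I_(w + 11)}) e : ~~ odd w ->
  rep g e -> ~~ e.1 -> nth 0%N e.2 0 = 0%N -> commute (rho (w + 11) (@Ordinal 5 0 isT)) g.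
Proof.
move=> ew rg /negPf e1 e0; apply/permP => i; apply: val_inj.
rewrite !permM val_rho0 // !rg val_rho0 // /eact e1.
have lw : (w < w + 11)%N by lia.
have gw : val (g (Ordinal lw)) = w by rewrite rg /eact e1 ltnn subnn e0 addn0.
have [iw|wi] := leqP i w.
  have -> : (if (i < w)%N then val i else (w + nth 0%N e.2 (i - w))%N) = i.
    by case: ltngtP iw => // -> _; rewrite subnn e0 addn0.
  have : (zig w i <= w)%N by rewrite /zig; repeat case: ifP => ?; lia.
  by case: ltngtP => // -> _; rewrite subnn e0 addn0.
have zi : zig w i = i by rewrite /zig; repeat case: ifP => ?; lia.
rewrite zi ltnNge ltnW //=.
have : val (g i) != w.
  apply: contraTneq wi => giw; rewrite -leqNgt.
  by have /perm_inj/(congr1 val) /= -> : g i = g (Ordinal lw) by apply: val_inj; rewrite giw gw.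
rewrite rg /eact e1 ltnNge ltnW //= /zig; repeat case: ifP => ?; lia.
Qed.

Lemma rho0_involution w : ~~ odd w ->
  rho (w + 11) (@Ordinal 5 0 isT) * rho (w + 11) (@Ordinal 5 0 isT) = 1.
Proof.
move=> ew; apply/permP => i; apply: val_inj; rewrite permM perm1 !val_rho0 // /zig.
case: (boolP (odd i)) => oi; case: (leqP 1 i) => i0; case: (leqP i w) => iw /=;
    repeat case: ifP => ?; lia.
Qed.

(** * Computations in <rho_1, ..., rho_4> *)

Definition idx (s : seq nat) : {set 'I_5} := [set i | val i \in s].

Definition Gs (w : nat) (s : seq nat) : {set {perm 'I_(w + 11)}} :=
  gen_sub (rho (w + 11)) (idx s).

(* Breadth-first search for representatives of the right cosets of the group encoded by [S]
   in the group generated by the [gen k], [k] in [J]; [S = [:: eid]] enumerates the group. *)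
Fixpoint explore (S : seq elt) (J : seq nat) (fuel : nat) (todo seen : seq elt) : seq elt :=
  if fuel is fuel'.+1 then
    if todo is t :: todo' then
      if has (fun l => ecomp l t \in seen) S then explore S J fuel' todo' seen
      else explore S J fuel' (todo' ++ [seq ecomp t (gen k) | k <- J]) (t :: seen)
    else seen
  else seen.

(* The fuel 1000 is enough for every enumeration below except that of <rho_1, ..., rho_4>
   (order 1320), which is only used as a list of some elements. *)
Definition reps (S : seq elt) (J : seq nat) : seq elt := explore S J 1000 [:: eid] [::].
Definition elts (J : seq nat) : seq elt := reps [:: eid] J.
Definition cosets (K J : seq nat) : seq elt := reps (elts K) J.

(** A certificate independent of how the search ended: if [S] encodes elements of <K>, the cosets of
    <K> represented in [ts] include the trivial one and are permuted among themselves by the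
    generators in [J]. *)
Definition covers (S ts : seq elt) (J : seq nat) : bool :=
  (eid \in ts) &&
  all (fun t => all (fun k => has (fun l => ecomp l (ecomp t (gen k)) \in ts) S) J) ts.

Definition stab (bs : seq nat) (e : elt) : bool :=
  all (fun j => (nth 0%N e.2 j \in bs) == (j \in bs)) (iota 0 11).

(** The one nontrivial element that no set of the last 11 vertices can detect. *)
Definition ez : elt := (true, iota 0 11).

(** Among the last 11 vertices rho_0 moves only x_(n-10), which has number 0. *)
Definition keeps (bs L : seq nat) : bool :=
  all (fun k => if k == 0%N then 0%N \notin bs else stab bs (gen k)) L.

(* The group of [L] preserves each set of [bss], and fixes x_1 if [1] is not in [L]; no
   nontrivial coset representative in [ts] may do so, except possibly the coset of [ez]. *)
Definition separating (S ts : seq elt) (L : seq nat) (bss : seq (seq nat)) (allow : bool) : bool :=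
  all (keeps^~ L) bss &&
  all (fun t => ((1%N \in L) || ~~ t.1) && all (stab^~ t) bss ==>
                (is_id t || allow && has (fun l => ecomp l t == ez) S)) ts.

Definition separates (K J L : seq nat) (bss : seq (seq nat)) (allow : bool) : bool :=
  let S := elts K in let ts := cosets K J in
  [&& all (mem J) K, all (mem L) K, 0%N \notin J, covers S ts J & separating S ts L bss allow].

Lemma mem_idx s (i : 'I_5) : (i \in idx s) = (val i \in s).
Proof. by rewrite inE. Qed.

Lemma idxS s t : all (mem t) s -> idx s \subset idx t.
Proof. by move/allP=> st; apply/subsetP=> i; rewrite !inE => /st. Qed.

(** Only soundness of the search is derived from its code; completeness is checked by [covers]. *)
Lemma explore_ind (P : elt -> Prop) S J fuel todo seen :
  (forall t k, P t -> k \in J -> P (ecomp t (gen k))) ->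
  (forall t, t \in todo -> P t) -> (forall t, t \in seen -> P t) ->
  forall t, t \in explore S J fuel todo seen -> P t.
Proof.
move=> PM; elim: fuel todo seen => //= fuel IH [|t todo] seen //= Ptodo Pseen.
have Pt : P t by apply: Ptodo; rewrite mem_head.
have Ptd s : s \in todo -> P s by move=> ts; apply: Ptodo; rewrite inE ts orbT.
case: ifP => _; first exact: IH.
apply: IH => s.
  rewrite mem_cat => /orP[/Ptd//|].
  move=> /mapP[k Jk ->].
  exact: PM.
rewrite inE => /orP[/eqP-> //|sn].
exact: Pseen.
Qed.

Arguments explore : simpl never.

Lemma reps_rep w S J e : ~~ odd w -> 0%N \notin J -> all (gtn 5) J ->
  e \in reps S J -> exists2 g, g \in Gs w J & rep g e.
Proof.
move=> ew J0 /allP J5; move: e.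
apply: (explore_ind (P := fun e => exists2 g, g \in Gs w J & rep g e)) => //.
  move=> t k [g Jg rg] Jk; have k5 := J5 _ Jk.
  have k0 : (0 < k)%N by rewrite lt0n; apply: contraNneq J0 => <-.
  exists (g * rho (w + 11) (Ordinal k5)).
    by rewrite groupM // gen_sub_mem // inE.
  by apply: rep_comp => //; apply: rep_rho.
by move=> t; rewrite inE => /eqP->; exists 1; [exact: group1 | exact: rep1].
Qed.

Definition realizes (w : nat) (K : seq nat) (S : seq elt) : Prop :=
  forall l, l \in S -> exists2 g, g \in Gs w K & rep g l.

Lemma covers_rep w K S ts J g : ~~ odd w -> 0%N \notin J -> realizes w K S ->
  covers S ts J -> g \in Gs w J ->
  exists2 h, h \in Gs w K & exists2 t, t \in ts & rep (h * g) t.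
Proof.
move=> ew J0 rS /andP[ts1 /allP clos].
move: g; apply: (gen_sub_ind (P := fun g => exists2 h, h \in Gs w K &
  exists2 t, t \in ts & rep (h * g) t)) => [|g i [h Kh [t tst rt]] Ji].
  by exists 1; [exact: group1 | exists eid => //; rewrite mulg1; apply: rep1].
rewrite inE in Ji.
have i0 : 0 < i by rewrite lt0n; apply: contraNneq J0 => <-.
have /hasP[l Sl ts'] := allP (clos t tst) _ Ji.
have [h' Kh' rh'] := rS l Sl.
exists (h' * h); first exact: groupM.
exists (ecomp l (ecomp t (gen i))) => //.
rewrite -mulgA; apply: rep_comp => //; rewrite mulgA; apply: rep_comp => //.
exact: rep_rho.
Qed.

(** * Separating cosets by invariant vertex sets *)

Definition inwin (w : nat) (bs : seq nat) (i : nat) : bool :=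
  (w <= i)%N && ((i - w)%N \in bs).

Lemma stab_rep w bs (g : {perm 'I_(w + 11)}) e : ~~ odd w -> rep g e ->
  stab bs e <-> (forall i, inwin w bs (val (g i)) = inwin w bs (val i)).
Proof.
move=> ew rg; split=> [/allP st i|inv].
  rewrite rg /eact /inwin; case: (ltnP (val i) w) => [iw|wi] /=.
    apply: negbTE; rewrite negb_and -ltnNge; apply/orP; left.
    by case: e.1 => //=; rewrite swp_lt.
  rewrite leq_addr addKn; apply/eqP/st; rewrite mem_iota.
  by case: i wi => i /=; lia.
apply/allP => j; rewrite mem_iota => /= lj.
have ltj : (w + j < w + 11)%N by rewrite ltn_add2l.
have := inv (Ordinal ltj); rewrite rg /eact /inwin /= ltnNge leq_addr /= !addKn leq_addr /=.
by move=> ->.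
Qed.

Lemma keeps_stab w bs L (x : {perm 'I_(w + 11)}) e : ~~ odd w -> keeps bs L ->
  x \in Gs w L -> rep x e -> stab bs e.
Proof.
move=> ew /allP kp Lx rx; apply/(stab_rep bs ew rx).
move: x Lx {e rx}; apply: gen_sub_ind => [i|x k inv Lk i]; first by rewrite perm1.
rewrite -(inv i) permM; move: (x i) => {}i.
rewrite inE in Lk; have := kp _ Lk; have [k0|k0] := posnP k; last first.
  by move=> /= st; exact: (proj1 (stab_rep bs ew (rep_rho ew k0)) st i).
move=> /= nb.
have -> : k = @Ordinal 5 0 isT by apply: val_inj.
rewrite val_rho0 // /inwin /zig.
case: ifP => // /andP[i0 iw].
have out j : (j <= w)%N -> (w <= j)%N && ((j - w)%N \in bs) = false.
  move=> jw; apply: contraNF nb => /andP[wj].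
  by rewrite (_ : j - w = 0)%N //; lia.
by rewrite !out //; case: ifP => ?; lia.
Qed.

(** The only edge at x_1 carries label 1. *)
Lemma fix0_rep w L (x : {perm 'I_(w + 11)}) e : ~~ odd w -> (0 < w)%N -> 1%N \notin L ->
  x \in Gs w L -> rep x e -> ~~ e.1.
Proof.
move=> ew w0 L1 Lx.
have lt0 : (0 < w + 11)%N by rewrite addn_gt0 w0.
suff fx : val (x (Ordinal lt0)) = 0%N.
  by move/(_ (Ordinal lt0)); rewrite fx /eact /= w0; case: e.1.
move: x Lx; apply: gen_sub_ind => [|x k]; first by rewrite perm1.
rewrite inE permM => fx Lk; rewrite (_ : x _ = Ordinal lt0); last exact: val_inj.
have [k0|k0] := posnP k.
  have -> : k = @Ordinal 5 0 isT by apply: val_inj.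
  by rewrite val_rho0.
rewrite (rep_rho ew k0) /eact /= w0; case: eqP => // k1.
by rewrite -k1 Lk in L1.
Qed.

(** As <K> is contained in <L>, the representative [h * g] of the coset of [g] still lies in <L> and
    has the invariants of <L>. The check leaves the trivial coset, or one that would put [ez] into
    <L>. *)
Lemma separating_sub w K J L S ts bss allow : ~~ odd w -> (0 < w)%N ->
  0%N \notin J -> all (mem L) K -> realizes w K S -> covers S ts J ->
  separating S ts L bss allow ->
  (allow -> forall x, x \in Gs w L -> ~ rep x ez) ->
  Gs w J :&: Gs w L \subset Gs w K.
Proof.
move=> ew w0 J0 sKL rS cov /andP[/allP kp /allP sep] noz.
have sub : {subset Gs w K <= Gs w L} by apply/subsetP/gen_subS/idxS.
apply/subsetP=> g /setIP[Jg Lg].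
have [h Kh [t tst rt]] := covers_rep ew J0 rS cov Jg.
have Lhg : h * g \in Gs w L by rewrite groupM // sub.
have := sep t tst; rewrite implybE => /orP[/negP[]|].
  apply/andP; split.
    by case: (boolP (1%N \in L)) => //= L1; apply: fix0_rep ew w0 L1 Lhg rt.
  by apply/allP => bs /kp kbs; apply: keeps_stab ew kbs Lhg rt.
case/orP=> [|/andP[al /hasP[l Sl /eqP lt]]].
  rewrite -(rep_eq1 w0 rt) => /eqP hg1.
  by rewrite -[g](mulKg h) hg1 mulg1 groupV.
have [h' Kh' rh'] := rS l Sl.
case: (noz al (h' * (h * g))); first by rewrite groupM // sub.
by rewrite -lt; apply: rep_comp.
Qed.

Lemma separatesP w K J L bss allow : ~~ odd w -> (0 < w)%N -> all (gtn 5) J ->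
  separates K J L bss allow ->
  (allow -> forall x, x \in Gs w L -> ~ rep x ez) ->
  Gs w J :&: Gs w L \subset Gs w K.
Proof.
move=> ew w0 /allP J5 /and5P[/allP sKJ sKL J0 cov sep].
have rS : realizes w K (elts K).
  move=> l; apply: reps_rep => //; first by apply: contra J0 => /sKJ.
  by apply/allP => k /sKJ /J5.
exact: separating_sub ew w0 J0 sKL rS cov sep.
Qed.

(* Conjugation by the dihedral group <rho_0, rho_1> sends c = rho_0 rho_1 to c or its inverse,
   but [ez] fixes a and x_(n-10) = c(a) and moves x_(n-12) = c(c(a)). *)
Lemma ez_not_dihedral w x : ~~ odd w -> (2 < w)%N ->
  x \in Gs w [:: 0; 1]%N -> ~ rep x ez.
Proof.
move=> ew w2 Gx rx.
pose r0 := rho (w + 11) (@Ordinal 5 0 isT); pose r1 := rho (w + 11) (@Ordinal 5 1 isT).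
have r00 : r0 * r0 = 1 by apply: rho0_involution.
have rr1 : rep r1 (gen 1) by apply: rep_rho.
have r11 : r1 * r1 = 1.
  apply/eqP; rewrite (rep_eq1 _ (rep_comp ew rr1 rr1)); last by lia.
  by vm_compute.
have V0 : r0^-1 = r0 by apply/eqP; rewrite eq_invg_mul r00.
have V1 : r1^-1 = r1 by apply/eqP; rewrite eq_invg_mul r11.
pose c := r0 * r1.
have cV : c^-1 = r1 * r0 by rewrite invMg V0 V1.
have dih : c ^ x = c \/ c ^ x = c^-1.
  move: x Gx {rx}; apply: gen_sub_ind => [|x k IH Lk]; first by left; rewrite conjg1.
  have ck : c ^ rho (w + 11) k = c^-1.
    rewrite inE in Lk; have [->|->] : k = @Ordinal 5 0 isT \/ k = @Ordinal 5 1 isT.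
    - case: k Lk => [[|[|k]] lk]; rewrite !inE //= => _; [left|right]; exact: val_inj.
    - by rewrite conjgE -/r0 V0 cV /c -!mulgA (mulgA r0) r00 mul1g.
    - by rewrite conjgE -/r1 V1 cV /c -!mulgA r11 mulg1.
  by rewrite conjgM; case: IH => ->; rewrite ?conjVg ck ?invgK; [right|left].
have lt1 : (w + 1 < w + 11)%N by lia.
have lt0 : (w < w + 11)%N by lia.
have ltm : (w - 2 < w + 11)%N by lia.
pose pa := Ordinal lt1; pose px := Ordinal lt0; pose py := Ordinal ltm.
have cpa : c pa = px.
  apply: val_inj; rewrite permM rr1 val_rho0 // /zig /eact /=.
  have -> : (w + 1 <= w)%N = false by lia.
  rewrite andbF.
  have -> : (w + 1 < w)%N = false by lia.
  by rewrite addKn addn0.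
have cpx : c px = py.
  apply: val_inj; rewrite permM rr1 val_rho0 // /zig /eact /=.
  rewrite leqnn (negPf ew) (_ : 0 < w)%N /=; last by lia.
  rewrite (_ : w.-1 < w)%N; last by lia.
  rewrite /swp; case: ifP => ?; lia.
have xpa : x pa = pa.
  apply: val_inj; rewrite rx /eact /=.
  have -> : (w + 1 < w)%N = false by lia.
  by rewrite addKn.
have xpx : x px = px.
  by apply: val_inj; rewrite rx /eact /= ltnn subnn addn0.
have xpy : x py != py.
  rewrite -val_eqE rx /eact /= (_ : w - 2 < w)%N; last by lia.
  rewrite /swp; case: ifP => ?; lia.
have xc p : x (c p) = (c ^ x) (x p) by rewrite permJ.
(* If [x] centralizes [c], it fixes [c (c pa) = py]; if it inverts [c], then [c px = pa], whereas
   [c px = py]. *)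
case: dih => E.
  by case/eqP: xpy; rewrite -cpx -[in LHS]cpa xc E xc E xpa cpa.
have := xc pa; rewrite cpa xpx E xpa => /(congr1 c).
rewrite permKV cpx => /(congr1 val) /=; lia.
Qed.

(** * The string C-group *)

Lemma idxD1 s (p : 'I_5) : idx s :\ p = idx [seq k <- s | k != val p].
Proof. by apply/setP => i; rewrite !inE mem_filter. Qed.

Lemma rho0_neq1 w : ~~ odd w -> (1 < w)%N -> rho (w + 11) (@Ordinal 5 0 isT) != 1.
Proof.
move=> ew w1; have lt1 : (1 < w + 11)%N by rewrite ltn_addr.
apply: contraTneq w1 => /permP/(_ (Ordinal lt1))/(congr1 val).
rewrite val_rho0 // perm1 /zig /=; case: ifP => //; lia.
Qed.

Lemma order_involution (gT : finGroupType) (x : gT) : x * x = 1 -> x != 1 -> #[x] = 2.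
Proof. by move=> xx x1; apply: (nt_prime_order (p := 2)) => //; rewrite expgS expg1. Qed.

Lemma order_rho w (k : 'I_5) : ~~ odd w -> (1 < w)%N -> #[rho (w + 11) k] = 2.
Proof.
move=> ew w1; apply: order_involution.
  have [k0|k0] := posnP k.
    by rewrite (_ : k = @Ordinal 5 0 isT) ?rho0_involution //; apply: val_inj.
  apply/eqP; have rk := rep_rho ew k0; rewrite (rep_eq1 _ (rep_comp ew rk rk)) ?(ltnW w1) //.
  by case: k k0 {rk} => [[|[|[|[|[|k]]]]] lk] //= _; vm_compute.
have [k0|k0] := posnP k.
  by rewrite (_ : k = @Ordinal 5 0 isT) ?rho0_neq1 //; apply: val_inj.
rewrite (rep_eq1 (ltnW w1) (rep_rho ew k0)).
by case: k k0 => [[|[|[|[|[|k]]]]] lk] //= _; vm_compute.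
Qed.

Lemma far_commute_rho w : ~~ odd w -> (1 < w)%N -> far_commute (rho (w + 11)).
Proof.
move=> ew w1 i j ij; have j0 : 0 < j by lia.
have rj := rep_rho ew j0; have [i0|i0] := posnP i.
  rewrite (_ : i = @Ordinal 5 0 isT); last exact: val_inj.
  by apply: (commute_rho0 ew rj); case: j ij {j0 rj} => [[|[|[|[|[|j]]]]] lj] //=; rewrite i0.
have ri := rep_rho ew i0.
have rij := rep_comp ew ri rj; have rji := rep_comp ew rj ri.
have comm : all (fun a => all (fun b => (a + 2 <= b) ==>
    (ecomp (gen a) (gen b) == ecomp (gen b) (gen a)))%N (iota 1 4)) (iota 1 4).
  by vm_compute.
have in14 (k : 'I_5) : 0 < k -> val k \in iota 1 4 by rewrite mem_iota => ->; apply: ltn_ord.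
have /eqP E := implyP (allP (allP comm _ (in14 _ i0)) _ (in14 _ j0)) ij.
by apply: rep_inj rij _; rewrite E.
Qed.

Lemma sggi_rho w : ~~ odd w -> (1 < w)%N -> sggi (rho (w + 11)).
Proof.
move=> ew w1; split=> [i|i j ij]; first exact: order_rho.
have c : commute (rho (w + 11) i) (rho (w + 11) j).
  by case/orP: ij => /(far_commute_rho ew w1).
have sq k : rho (w + 11) k ^+ 2 = 1 by apply/eqP; rewrite -order_dvdn order_rho.
by rewrite expgMn // !sq mulg1.
Qed.

Lemma ip_idx_step w (p q : 'I_5) s :
  ~~ odd w -> (1 < w)%N -> all (fun k => val p <= k <= val q) s ->
  ip_on (rho (w + 11)) (idx [seq k <- s | k != val p]) ->
  ip_on (rho (w + 11)) (idx [seq k <- s | k != val q]) ->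
  Gs w [seq k <- s | k != val p] :&: Gs w [seq k <- s | k != val q] \subset
    Gs w [seq k <- s | (k != val p) && (k != val q)] ->
  ip_on (rho (w + 11)) (idx s).
Proof.
move=> ew w1 /allP pq ipp ipq mid; apply: (ip_extend (p := p) (q := q)).
- exact: far_commute_rho.
- by move=> i; rewrite inE => /pq.
- by rewrite idxD1.
- by rewrite idxD1.
- rewrite !idxD1; apply: subset_trans mid _.
  by apply/gen_subS/subsetP => i; rewrite !inE !mem_filter => /andP[/andP[-> ->] ->].
Qed.

Lemma intersection_rho w : ~~ odd w -> (2 < w)%N -> intersection_property (rho (w + 11)).
Proof.
move=> ew w2; have w1 : (1 < w)%N by apply: ltnW.
have w0 : (0 < w)%N by apply: ltnW.
have sep K J L bss : all (gtn 5) J -> separates K J L bss false ->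
    Gs w J :&: Gs w L \subset Gs w K.
  by move=> J5 S; apply: (separatesP ew w0 J5 S).
pose o k lt := @Ordinal 5 k lt.
have one k (lt : (k < 5)%N) : ip_on (rho (w + 11)) (idx [:: k]).
  rewrite (_ : idx _ = [set Ordinal lt]); first exact: ip_on1.
  by apply/setP => i; rewrite !inE -val_eqE.
have step p q lp lq s := @ip_idx_step w (o p lp) (o q lq) s ew w1.
(* No vertex set is needed here and for [ip12]: rho_1 moves x_1, which the other generator fixes. *)
have ip01 : ip_on (rho (w + 11)) (idx [:: 0; 1]%N).
  apply: (step 0 1 isT isT)%N => //=; try exact: one.
  by apply: (sep _ _ _ [::]); [by [] | by vm_compute].
have ip12 : ip_on (rho (w + 11)) (idx [:: 1; 2]%N).
  apply: (step 1 2 isT isT)%N => //=; try exact: one.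
  by rewrite setIC; apply: (sep _ _ _ [::]); [by [] | by vm_compute].
(* Vertex 1 is a, fixed by rho_3 but not by rho_2; in [ip34], vertex 2 is b, fixed by rho_4 but not
   by rho_3. *)
have ip23 : ip_on (rho (w + 11)) (idx [:: 2; 3]%N).
  apply: (step 2 3 isT isT)%N => //=; try exact: one.
  by rewrite setIC; apply: (sep _ _ _ [:: [:: 1]]%N); [by [] | by vm_compute].
have ip34 : ip_on (rho (w + 11)) (idx [:: 3; 4]%N).
  apply: (step 3 4 isT isT)%N => //=; try exact: one.
  by rewrite setIC; apply: (sep _ _ _ [:: [:: 2]]%N); [by [] | by vm_compute].
(* Both b and c are fixed by rho_0 and rho_1, but (rho_1 rho_2)^3 is [ez], so its coset has to be
   excluded by the dihedral argument. *)
have ip012 : ip_on (rho (w + 11)) (idx [:: 0; 1; 2]%N).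
  apply: (step 0 2 isT isT)%N => //=.
  apply: (separatesP (bss := [:: [:: 2]; [:: 3]]%N) (allow := true) ew w0);
    [by [] | by vm_compute |].
  by move=> _ x Gx; apply: ez_not_dihedral Gx.
(* x_(n-10) is fixed by rho_2, rho_3 and rho_4; it serves again for [ip1234]. *)
have ip123 : ip_on (rho (w + 11)) (idx [:: 1; 2; 3]%N).
  apply: (step 1 3 isT isT)%N => //=; rewrite setIC.
  by apply: (sep _ _ _ [:: [:: 0]]%N); [by [] | by vm_compute].
have ip234 : ip_on (rho (w + 11)) (idx [:: 2; 3; 4]%N).
  apply: (step 2 4 isT isT)%N => //=; rewrite setIC.
  by apply: (sep _ _ _ [:: [:: 1]]%N); [by [] | by vm_compute].
(* {c, e, h} is an orbit of <rho_0, rho_1, rho_2>. *)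
have ip0123 : ip_on (rho (w + 11)) (idx [:: 0; 1; 2; 3]%N).
  apply: (step 0 3 isT isT)%N => //=.
  by apply: (sep _ _ _ [:: [:: 3; 5; 8]]%N); [by [] | by vm_compute].
have ip1234 : ip_on (rho (w + 11)) (idx [:: 1; 2; 3; 4]%N).
  apply: (step 1 4 isT isT)%N => //=; rewrite setIC.
  by apply: (sep _ _ _ [:: [:: 0]]%N); [by [] | by vm_compute].
have ip01234 : ip_on (rho (w + 11)) (idx [:: 0; 1; 2; 3; 4]%N).
  apply: (step 0 4 isT isT)%N => //=.
  by apply: (sep _ _ _ [:: [:: 4; 6; 7; 9; 10]]%N); [by [] | by vm_compute].
move=> J K; apply: ip01234; apply/subsetP => i _; rewrite inE;
  by case: i => [[|[|[|[|[|i]]]]] li].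
Qed.

(** * Orders of the products of consecutive generators *)

(** Labels 1 and 0 alternate along x_1, ..., x_(n-10), a, so rho_0 rho_1 advances by two, odd
    positions upwards and even ones downwards, turning at both ends: a single cycle on [w + 2]
    points. *)
Lemma rho01_step w i : ~~ odd w -> (0 < w)%N -> (i < w + 2)%N ->
  eact w (gen 1) (zig w i) =
  if i == w.+1 then w else if odd i then (i + 2)%N else if i == 0%N then 1%N else (i - 2)%N.
Proof.
move=> ew w0 iw; have [ltw|gew] := ltnP (zig w i) w.
  rewrite /eact ltw -[(gen 1).1]/true /swp; move: ltw; rewrite /zig.
  case: (boolP (odd i)) => oi; case: (leqP 1 i) => i0; case: (leqP i w) => iw' /=;
    repeat case: ifP => ?; lia.
have [zw|zw] : zig w i = w /\ i = w.-1 \/ zig w i = w.+1 /\ i = w.+1.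
- move: gew; rewrite /zig.
  case: (boolP (odd i)) => oi; case: (leqP 1 i) => i0; case: (leqP i w) => iw' /=; lia.
- case: zw => -> ->; rewrite /eact ltnn subnn -[nth _ _ _]/1%N.
  repeat case: ifP => ?; lia.
- case: zw => -> ->; rewrite /eact ltnNge leqnSn subSnn -[nth _ _ _]/0%N /=.
  repeat case: ifP => ?; lia.
Qed.

Lemma order_rho01 w : ~~ odd w -> (1 < w)%N ->
  #[rho (w + 11) (@Ordinal 5 0 isT) * rho (w + 11) (@Ordinal 5 1 isT)] = (w + 2)%N.
Proof.
move=> ew w1; have w0 := ltnW w1; set c := _ * _.
have rr1 : rep (rho (w + 11) (@Ordinal 5 1 isT)) (gen 1) by apply: rep_rho.
have vc i : val (c i) = eact w (gen 1) (zig w (val i)) by rewrite permM rr1 val_rho0.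
have lt0 : (0 < w + 11)%N by lia.
pose p0 := Ordinal lt0; pose N := (w + 2)%N.
(* [f k] is the image of x_1 under [c ^+ k]. *)
pose f k := if (k == 0)%N then 0%N else if (k.*2 <= N)%N then k.*2.-1 else (N - k).*2.
have fN k : (k <= N)%N -> (f k < w + 2)%N.
  by move=> kN; rewrite /f; case: (posnP k) => k0; [lia | case: (leqP k.*2 N) => kk; lia].
have next k : (k < N)%N -> eact w (gen 1) (zig w (f k)) = f k.+1.
  move=> kN; rewrite rho01_step ?fN ?(ltnW kN) // /f /N.
  by case: (posnP k) => k0; case: (leqP k.*2 (w + 2)) => kk; case: (leqP k.+1.*2 (w + 2)) => kk';
    rewrite /=; repeat case: ifP => ?; lia.
have fc k : (k <= N)%N -> val ((c ^+ k) p0) = f k.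
  elim: k => [|k IH] kN; first by rewrite perm1.
  by rewrite expgSr permM vc IH ?next // ltnW.
have cN0 : (c ^+ N) p0 = p0.
  apply: val_inj; rewrite fc // /f /N /=; repeat case: ifP => ?; lia.
have cN : c ^+ N = 1.
  apply/permP => i; rewrite perm1; have [iw|wi] := ltnP (val i) N.
    have [k kN fk] : exists2 k, (k < N)%N & f k = val i.
      move: (val i) iw => j jN.
      (* The place of [j] along the cycle, inverting [f]. *)
      exists (if odd j then j.+1./2 else if j == 0%N then 0%N else (N - j./2)%N).
        by rewrite /N in jN *; repeat case: ifP => ?; lia.
      rewrite /f /N in jN *; case: (boolP (odd j)) => oj.
        by repeat case: ifP => ?; lia.
      by case: (posnP j) => j0 //; repeat case: ifP => ?; lia.
    have -> : i = (c ^+ k) p0 by apply: val_inj; rewrite fc // ltnW.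
    by rewrite -permM -expgD (addnC k N) expgD permM cN0.
  (* Beyond a, rho_1 never reaches x_(n-10), so rho_0 is trivial there and [c] acts as an involution
     or trivially; [N] is even. *)
  have far : all (fun j => (1 < j) ==> (0 < nth 0 (gen 1).2 j))%N (iota 0 11) by vm_compute.
  have c2 : (c ^+ 2) i = i.
    have z (j : 'I_(w + 11)) : (w < val j)%N -> rho (w + 11) (@Ordinal 5 0 isT) j = j.
      by move=> wj; apply: val_inj; rewrite val_rho0 // /zig; case: ifP => //; lia.
    have wi' : (w < val i)%N by rewrite /N in wi; lia.
    rewrite expgS expg1 !permM (z i) // z.
      rewrite -permM (_ : _ * _ = 1) ?perm1 //; apply/eqP.
      by rewrite -[_ * _]/(_ ^+ 2) -order_dvdn order_rho //; lia.
    have nz : (0 < nth 0%N (gen 1).2 (val i - w))%N.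
      apply: (implyP (allP far _ _)); last by rewrite /N in wi; lia.
      by rewrite mem_iota; case: i {wi} wi' => i /=; lia.
    rewrite rr1 /eact (leq_gtF (ltnW wi')).
    by move: (nth _ _ _) nz => v; lia.
  rewrite (_ : N = (2 * N./2)%N); last by rewrite /N; lia.
  rewrite expgM; elim: (N./2) => [|m IH]; first by rewrite perm1.
  by rewrite expgSr permM IH.
(* For 0 < k <= N, [f k] vanishes only at [k = N], so the order cannot be smaller. *)
have mN : (#[c] <= N)%N by rewrite dvdn_leq ?order_dvdn ?cN // /N; lia.
have := fc _ mN; rewrite expg_order perm1 /= => /esym.
have := order_gt0 c; rewrite /f; move: #[c] mN => m mN m0.
by rewrite -/N; repeat case: ifP => ?; lia.
Qed.

Definition epow (e : elt) (m : nat) : elt := iter m (ecomp^~ e) eid.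

Definition has_order (e : elt) (m : nat) : bool :=
  is_id (epow e m) && all (fun d => ~~ is_id (epow e d)) (iota 1 m.-1).

Lemma order_rep w (g : {perm 'I_(w + 11)}) e m : ~~ odd w -> (0 < w)%N -> (0 < m)%N ->
  rep g e -> has_order e m -> #[g] = m.
Proof.
move=> ew w0 m0 rg /andP[em /allP ed].
have gm : #[g] %| m by rewrite order_dvdn (rep_eq1 w0 (rep_expg m ew rg)).
have := dvdn_leq m0 gm; rewrite leq_eqVlt => /orP[/eqP //|lt].
have /negP[] : ~~ is_id (epow e #[g]).
  by apply: ed; rewrite mem_iota order_gt0 add1n prednK.
by rewrite -(rep_eq1 w0 (rep_expg _ ew rg)) expg_order.
Qed.

Lemma schlafli_rho w : ~~ odd w -> (1 < w)%N ->
  schlafli_type (rho (w + 11)) [:: w + 2; 6; 5; 3]%N.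
Proof.
move=> ew w1; split=> // j i ij; have w0 := ltnW w1.
have j0 : 0 < j by rewrite -ij.
have [i0|i0] := posnP i.
  rewrite i0 /= -(order_rho01 ew w1); congr #[rho _ _ * rho _ _]; apply: val_inj => //=.
  by rewrite /= -ij i0.
(* The leading 0 is a placeholder: rho_0 rho_1 is treated above. *)
have orders : all (fun k => has_order (ecomp (gen k) (gen k.+1))
    (nth 0 [:: 0; 6; 5; 3] k)%N) (iota 1 3).
  by vm_compute.
have i13 : val i \in iota 1 3.
  by rewrite mem_iota i0 /=; have := ltn_ord j; rewrite -ij.
have := rep_comp ew (rep_rho ew i0) (rep_rho ew j0); rewrite -ij => rij.
rewrite (order_rep ew w0 _ rij (allP orders _ i13)).
  by move: i13; rewrite !inE => /or3P[] /eqP /= ->.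
by move: i13; rewrite !inE => /or3P[] /eqP /= ->.
Qed.

(** * Parity and a criterion for the alternating group *)

Lemma odd_perm_tp n u v : (u < n)%N -> (v < n)%N -> u != v -> odd_perm (tp n u v).
Proof.
move=> un vn uv; rewrite /tp (insubT (fun i => i < n)%N un) (insubT (fun i => i < n)%N vn) /=.
by rewrite odd_tperm -val_eqE.
Qed.

Lemma odd_perm_prod_tp n (es : seq (nat * nat * seq nat)) (P : pred (nat * nat * seq nat)) :
  all (fun e => [&& e.1.1 < n, e.1.2 < n & e.1.1 != e.1.2])%N es ->
  odd_perm (\prod_(e <- es | P e) tp n e.1.1 e.1.2) = odd (count P es).
Proof.
elim: es => [|[[u v] s] es IH] /=; first by rewrite big_nil odd_perm1.
case/andP=> /and3P[un vn uv] les; rewrite big_cons oddD -IH //.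
by case: ifP => _; rewrite // odd_permM odd_perm_tp.
Qed.

(** Each of the labels 1, 2, 3, 4 occurs on four edges of [wedges], and any four consecutive edges
    of the path carry 0 and 1 twice each. *)
Lemma even_rho w (k : 'I_5) : (4 %| w)%N -> odd_perm (rho (w + 11) k) = false.
Proof.
case/dvdnP=> m ->; rewrite /rho odd_perm_prod_tp graph_edgesE.
  rewrite count_cat !count_map oddD.
  set c2 := count _ wedges.
  have -> : odd c2 = false by rewrite /c2; case: k {c2} => [[|[|[|[|[|k]]]]] lk].
  rewrite addbF {c2}; elim: m => [|m IH] //.
  rewrite mulSn addnC iotaD count_cat oddD IH.
  have om : odd (m * 4) = false by rewrite oddM andbF.
  rewrite add1n /= !inE om /=.
  by case: k {IH} => [[|[|[|[|[|k]]]]] lk].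
rewrite all_cat; apply/andP; split; last first.
  rewrite all_map; apply/allP => e; rewrite !inE.
  by do !(case/orP=> [/eqP->|]); try move/eqP->; rewrite /= !ltn_add2l eqn_add2l.
rewrite all_map; apply/allP => s; rewrite mem_iota /=; lia.
Qed.

(** The transpositions through [b] generate the symmetric group, and the union of [H] and its coset
    by [tperm b c] is closed under right multiplication by them. Parity puts the even elements into
    [H]. *)
Lemma Alt_eq_of_tperm (T : finType) (H : {group {perm T}}) (b c : T) : b != c ->
  H \subset Alt T -> (forall y, y != b -> tperm b y * tperm b c \in H) ->
  H = Alt T :> {set {perm T}}.
Proof.
move=> bc HA Hy; apply/eqP; rewrite eqEsubset HA /=; apply/subsetP => s.
rewrite Alt_even => es.
have tt : tperm b c * tperm b c = 1 by exact: tperm2.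
have cover x : x \in [set: {perm T}] -> x \in H \/ x * tperm b c \in H.
  rewrite -(gen_tperm b).
  apply: (gen_ind_r (P := fun x => x \in H \/ x * tperm b c \in H)) => [|{}x a IH].
    by left; apply: group1.
  case/imsetP=> y _ ->; have [->|yb] := eqVneq y b; first by rewrite tperm1 mulg1.
  case: IH => xH; [right|left].
    by rewrite -mulgA groupM ?Hy.
  have -> : x * tperm b y = (x * tperm b c) * (tperm b y * tperm b c)^-1.
    by rewrite invMg !tpermV mulgA -(mulgA x) tt mulg1.
  by rewrite groupM ?groupV ?Hy.
case: (cover s (in_setT s)) => // /(subsetP HA).
by rewrite Alt_even odd_permM odd_tperm bc addbT negbK (negPf es).
Qed.

(** A 3-cycle may be started at any of its points; this moves the base point of the 3-cycles from
    x_(n-11) to b. *)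
Lemma tperm_rot (T : finType) (x y z : T) : x != y -> x != z -> y != z ->
  tperm x y * tperm x z = tperm y z * tperm y x.
Proof.
move=> xy xz yz; have := tpermJ x z (tperm x y).
rewrite tpermL tpermD // 1?eq_sym // => <-.
by rewrite conjgE tpermV (tpermC y x) -!mulgA tperm2 mulg1.
Qed.

(** * The alternating group *)

Lemma rho_in_Gs w (k : 'I_5) : rho (w + 11) k \in Gs w (iota 0 5).
Proof. by rewrite gen_sub_mem // inE mem_iota ltn_ord. Qed.

(* If [g] fixes every x_s with s <= n - 11, then rho_0 acts on the support of [g] as the
   transposition of x_(n-11) and x_(n-10), so the commutator of [g] and rho_0 is a 3-cycle. *)
Lemma commg_rho0 w (g : {perm 'I_(w + 11)}) e (p q : 'I_(w + 11)) :
  ~~ odd w -> (1 < w)%N -> rep g e -> ~~ e.1 -> val p = w.-1 -> val q = w ->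
  [~ g, rho (w + 11) (@Ordinal 5 0 isT)] = tperm p (g q) * tperm p q.
Proof.
move=> ew w1 rg /negPf e1 vp vq; set r := rho _ _; set t := tperm p q.
have vr (x : 'I_(w + 11)) : val (r x) = zig w (val x) by apply: val_rho0.
have rp : r p = q by apply: val_inj; rewrite vr vp vq /zig; repeat case: ifP => ?; lia.
have rq : r q = p by apply: val_inj; rewrite vr vp vq /zig; repeat case: ifP => ?; lia.
have gp : g p = p.
  by apply: val_inj; rewrite rg /eact e1 vp (_ : w.-1 < w)%N //; lia.
have ctr : commute t r.
  by rewrite /commute conjgC tpermJ rp rq tpermC.
(* [s] is rho_0 without its last transposition; it moves only vertices before x_(n-11), all fixed by
   [g], so the two commute and [g ^ r = g ^ t]. *)
pose s := t * r.
have s_ge (x : 'I_(w + 11)) : (w.-1 <= val x)%N -> s x = x.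
  move=> wx; rewrite permM; case: tpermP => [->|->|/eqP xp /eqP xq] //.
  apply: val_inj; rewrite vr /zig.
  rewrite -!val_eqE vp vq in xp xq.
  by move: (val x) wx xp xq => j; repeat case: ifP => ?; lia.
have s_lt (x : 'I_(w + 11)) : (val x < w.-1)%N -> (val (s x) < w.-1)%N.
  move=> xw; have px : p != x by apply: contraTneq xw => <-; rewrite vp ltnn.
  have qx : q != x by apply: contraTneq xw => <-; rewrite vq -leqNgt leq_pred.
  rewrite permM tpermD // vr /zig.
  by move: (val x) xw => j jw; repeat case: ifP => ?; lia.
have g_lt (x : 'I_(w + 11)) : (val x < w)%N -> g x = x.
  by move=> xw; apply: val_inj; rewrite rg /eact e1 xw.
have g_ge (x : 'I_(w + 11)) : (w <= val x)%N -> (w <= val (g x))%N.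
  by move=> wx; rewrite rg /eact ltnNge wx leq_addr.
have cgs : commute g s.
  apply/permP => x; rewrite permM [RHS]permM; have [xw|wx] := ltnP (val x) w.-1.
    have sw := s_lt x xw.
    have le z : (z < w.-1)%N -> (z < w)%N by move=> zw; apply: leq_trans zw (leq_pred w).
    by rewrite (g_lt x (le _ xw)) (g_lt (s x) (le _ sw)).
  rewrite (s_ge x wx) s_ge //; have [xw|] := ltnP (val x) w; first by rewrite g_lt.
  by move/g_ge; apply: leq_trans; apply: leq_pred.
have rE : r = t * s by rewrite /s mulgA tperm2 mul1g.
have cts : commute t s by apply: commuteM.
have Jr : g ^ r = g ^ t.
  by rewrite rE conjgM conjJg !conjgE cgs cts !mulKg.
rewrite commgEl Jr conjgE tpermV !mulgA.
have -> : g^-1 * t * g = t ^ g by rewrite conjgE mulgA.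
by rewrite tpermJ gp.
Qed.

(** The images of x_(n-10) under elements to which [commg_rho0] applies exhaust the other ten
    vertices. *)
Definition moves (S : seq elt) : bool :=
  all (fun j => has (fun e => ~~ e.1 && (nth 0%N e.2 0 == j)) S) (iota 1 10).

Lemma realized_moves w : ~~ odd w ->
  exists2 S, realizes w [:: 1; 2; 3; 4]%N S & moves S.
Proof.
move=> ew; exists (reps [:: eid] [:: 1; 2; 3; 4]%N); last by vm_compute.
by move=> e; exact: (@reps_rep w [:: eid] [:: 1; 2; 3; 4]%N e ew isT isT).
Qed.

Lemma three_cycles w (p q : 'I_(w + 11)) y :
  ~~ odd w -> (1 < w)%N -> val p = w.-1 -> val q = w -> (w <= val y)%N ->
  tperm p y * tperm p q \in Gs w (iota 0 5).
Proof.
move=> ew w1 vp vq wy; have [->|yq] := eqVneq y q; first by rewrite tperm2 group1.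
have [S rS /allP mv] := realized_moves ew.
have j10 : (val y - w)%N \in iota 1 10.
  by rewrite -val_eqE vq in yq; rewrite mem_iota; case: y wy yq => y /=; lia.
have /hasP[e He /andP[e1 /eqP e0]] := mv _ j10.
have [g Hg rg] := rS e He.
have <- : g q = y.
  by apply: val_inj; rewrite rg /eact vq ltnn subnn e0 subnKC.
rewrite -(commg_rho0 ew w1 rg e1 vp vq) groupR ?rho_in_Gs //.
by apply: subsetP Hg; apply/gen_subS/idxS.
Qed.

Lemma Gs_Alt w : (4 %| w)%N -> (1 < w)%N -> Gs w (iota 0 5) = Alt 'I_(w + 11).
Proof.
move=> w4 w1; have ew : ~~ odd w by lia.
pose G := [group of gen_sub (rho (w + 11)) (idx (iota 0 5))].
have lt j : (j < 12)%N -> (w.-1 + j < w + 11)%N by lia.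
pose v j (lj : (j < 12)%N) := Ordinal (lt j lj).
(* Counted from position [w.-1], these are x_(n-11), x_(n-10), b and c. *)
pose p := @v 0%N isT; pose q := @v 1%N isT; pose b := @v 3%N isT; pose c := @v 4%N isT.
have vp : val p = w.-1 by rewrite /= addn0.
have vq : val q = w by rewrite /=; lia.
have pq y : (w <= val y)%N -> tperm p y * tperm p q \in G.
  by move=> wy; apply: three_cycles.
have swap (x y z : 'I_(w + 11)) : tperm x y * tperm x z \in G -> tperm x z * tperm x y \in G.
  by rewrite -groupV invMg !tpermV.
have comp (x y z u : 'I_(w + 11)) : tperm x y * tperm x u \in G -> tperm x u * tperm x z \in G ->
    tperm x y * tperm x z \in G.
  move=> yu uz; have := groupM yu uz.
  by rewrite mulgA -(mulgA (tperm x y)) tperm2 mulg1.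
have np y : (w <= val y)%N -> p != y.
  by move=> wy; apply: contraTneq wy => <-; rewrite vp; lia.
have wb : (w <= val b)%N by rewrite /=; lia.
have wc : (w <= val c)%N by rewrite /=; lia.
have bc : b != c by rewrite -val_eqE /=; lia.
have rot y : (w <= val y)%N -> b != y -> tperm b y * tperm b p \in G.
  move=> wy yb; rewrite -tperm_rot ?np //.
  by apply: comp (pq b wb) _; apply/swap/pq.
have D_ge y : (w <= val y)%N -> y != b -> tperm b y * tperm b c \in G.
  by move=> wy yb; apply: comp (rot y wy _) (swap _ _ _ (rot c wc bc)); rewrite eq_sym.
have pbc : tperm b p * tperm b c \in G by apply/swap/rot.
have r0fix (x : 'I_(w + 11)) : (w < val x)%N -> rho (w + 11) (@Ordinal 5 0 isT) x = x.
  by move=> wx; apply: val_inj; rewrite val_rho0 // /zig ifF //; lia.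
have r0b : rho (w + 11) (@Ordinal 5 0 isT) b = b by apply: r0fix; rewrite /=; lia.
have r0c : rho (w + 11) (@Ordinal 5 0 isT) c = c by apply: r0fix; rewrite /=; lia.
have conj (k : 'I_5) y : rho (w + 11) k b = b -> rho (w + 11) k c = c ->
    tperm b y * tperm b c \in G -> tperm b (rho (w + 11) k y) * tperm b c \in G.
  move=> kb kc By; have := rho_in_Gs w k => Gk.
  by have := groupJ By Gk; rewrite conjMg !tpermJ kb kc.
(* Descent along the path from [p]: rho_0 leads from position [y + 1] to [y] for odd [y], rho_1 for
   even [y]. *)
have D_lt m y : (val y + m)%N = w.-1 -> tperm b y * tperm b c \in G.
  elim: m y => [|m IH] y ym.
    by rewrite (_ : y = p) //; apply: val_inj; rewrite vp -ym addn0.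
  have lty : ((val y).+1 < w + 11)%N by lia.
  have [oy|ey] := boolP (odd (val y)).
    have -> : y = rho (w + 11) (@Ordinal 5 0 isT) (Ordinal lty).
      apply: val_inj; rewrite val_rho0 // /zig.
      by rewrite [val (Ordinal _)]/= /= oy (_ : val y < w)%N //; lia.
    by apply: conj; rewrite ?r0b ?r0c //; apply: IH; rewrite /= addSnnS.
  have r1 := rep_rho (k := @Ordinal 5 1 isT) ew isT.
  have -> : y = rho (w + 11) (@Ordinal 5 1 isT) (Ordinal lty).
    apply: val_inj; rewrite r1 /eact /= (_ : (val y).+1 < w)%N; last by lia.
    by rewrite /swp /= ey.
  apply: conj; last by apply: IH; rewrite /= addSnnS.
    apply: val_inj; rewrite r1 /eact /= ifF; last by lia.
    by rewrite (_ : w.-1 + 3 - w = 2)%N -?[nth _ _ _]/2%N; lia.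
  apply: val_inj; rewrite r1 /eact /= ifF; last by lia.
  by rewrite (_ : w.-1 + 4 - w = 3)%N -?[nth _ _ _]/3%N; lia.
apply: (@Alt_eq_of_tperm _ G b c).
- exact: bc.
- rewrite gen_subG; apply/subsetP => _ /imsetP[k _ ->].
  by rewrite Alt_even even_rho.
- move=> y yb; have [yw|wy] := ltnP (val y) w; last exact: D_ge.
  by apply: (D_lt (w.-1 - val y)%N); rewrite subnKC // -ltnS prednK // ltnW.
Qed.

Local Close Scope group_scope.

Theorem theorem4p14 (n : nat) :
  (15 <= n)%N -> n %% 4 = 3 ->
  (gen_group (rho n) \isog Alt 'I_n) /\
  string_C_group (rho n) /\
  schlafli_type (rho n) [:: n - 9; 6; 5; 3]%N.
Proof.
move=> n15 n4; have [w [-> w4 w2]] : exists w, [/\ n = w + 11, 4 %| w & 2 < w]%N.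
  by exists (n - 11)%N; split; lia.
have ew : ~~ odd w by lia.
have w1 : (1 < w)%N by apply: ltnW.
split; last split.
- rewrite /gen_group (_ : setT = idx (iota 0 5)).
    by rewrite -[gen_sub _ _]/(Gs w _) Gs_Alt // isog_refl.
  by apply/setP => i; rewrite in_setT mem_idx mem_iota ltn_ord.
- by split; [apply: sggi_rho | apply: intersection_rho].
- by rewrite (_ : w + 11 - 9 = w + 2)%N; [apply: schlafli_rho | lia].
Qed.
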